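(* Let $r\ge 2$ and $2\le\ell_1\le\cdots\le\ell_r$ be integers, and let $G$ be a finite abelian group with $|G|=n$. Then $$\mathrm{ex}\big(n,K^{(r)}_{\ell_1,\dots,\ell_r}\big)\ge \binom nr\,\frac{F\big(G,\mathcal L^{(r)}_{\ell_1,\dots,\ell_r}\big)}{n}.$$
   Context: $K^{(r)}_{\ell_1,\dots,\ell_r}$ is the complete $r$-partite $r$-uniform hypergraph with vertex set $V=V_1\cup\cdots\cup V_r$, where $V_1,\dots,V_r$ are pairwise disjoint with $|V_i|=\ell_i$, and with hyperedge set $\{\{x_1,\dots,x_r\}: x_i\in V_i,\ i=1,\dots,r\}$. $\mathrm{ex}(n,K^{(r)}_{\ell_1,\dots,\ell_r})$ is the maximum number of hyperedges of an $r$-uniform hypergraph on $n$ vertices which does not contain $K^{(r)}_{\ell_1,\dots,\ell_r}$ as a (not necessarily induced) sub-hypergraph. A set $A\subset G$ is called $\mathcal L^{(r)}_{\ell_1,\dots,\ell_r}$-free if $A$ contains no sumset $L_1+\cdots+L_r=\{\lambda_1+\cdots+\lambda_r:\lambda_i\in L_i\}$ with $L_i\subset G$ and $|L_i|=\ell_i$ for $i=1,\dots,r$ (the sums need not be pairwise distinct). $F(G,\mathcal L^{(r)}_{\ell_1,\dots,\ell_r})$ denotes the largest size of an $\mathcal L^{(r)}_{\ell_1,\dots,\ell_r}$-free set in $G$. *)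

(* Defs.v *)
From HB Require Import structures.
From mathcomp Require Import all_boot all_order all_algebra.
Set Implicit Arguments.
Unset Strict Implicit.
Unset Printing Implicit Defensive.

Import GRing.Theory.
Local Open Scope ring_scope.

(* A hypergraph on the vertex type T is given by its set of hyperedges. *)
Definition uniform (T : finType) (r : nat) (E : {set {set T}}) : bool :=
  [forall e in E, #|e| == r].

(* E contains a copy, not necessarily induced, of the hypergraph H. *)
Definition contains_copy (U T : finType)
    (H : {set {set U}}) (E : {set {set T}}) : bool :=
  [exists f : {ffun U -> T}, injectiveb f && [forall e in H, f @: e \in E]].

Definition turan_number (n r : nat) (U : finType) (H : {set {set U}}) : nat :=
  \max_(E : {set {set 'I_n}} | uniform r E && ~~ contains_copy H E) #|E|.

(* The vertex type is the disjoint union of the classes V_i = 'I_(l i); the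
   hyperedges are the sets {x_1, ..., x_r} with x_i in V_i. *)
Definition complete_multipartite (r : nat) (l : 'I_r -> nat) :
    {set {set {i : 'I_r & 'I_(l i)}}} :=
  [set [set Tagged (fun i => 'I_(l i)) (x i) | i : 'I_r]
     | x : {dffun forall i : 'I_r, 'I_(l i)}].

Definition sumset (G : finZmodType) (r : nat) (L : 'I_r -> {set G}) : {set G} :=
  [set \sum_i x i | x : {ffun 'I_r -> G} in family L].

Definition sumset_free (G : finZmodType) (r : nat) (l : 'I_r -> nat)
    (A : {set G}) : bool :=
  [forall L : {ffun 'I_r -> {set G}},
     [forall i, #|L i| == l i] ==> ~~ (sumset L \subset A)].

Definition max_sumset_free (G : finZmodType) (r : nat) (l : 'I_r -> nat) : nat :=
  \max_(A : {set G} | sumset_free l A) #|A|.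

(* Main.v *)
Require Import Defs.
From HB Require Import structures.
From mathcomp Require Import all_boot all_order all_algebra.
Import Order.TTheory GRing.Theory Num.Theory.
Local Open Scope ring_scope.

(** Let [A] be a sumset-free subset of [G]. Identify the vertices with the
    elements of [G], and for each [a] in [G] take as hyperedges the [r]-sets
    whose sum lands in [A] after translation by [a]. A copy of the complete
    [r]-partite hypergraph in it would send its classes to sets [L_i] of sizes
    [l i] such that [a + (L_1 + ... + L_r)] is contained in [A]; absorbing [a]
    into one of the [L_i] gives a forbidden sumset, so none of these hypergraphs
    contains a copy ([translate_hypergraph_free]). On the other hand every
    [r]-set is a hyperedge for exactly [#|A|] translates [a], so the [n]
    hypergraphs have ['C(n, r) * #|A|] hyperedges altogether
    ([sum_card_translate_hypergraph]). Each has at most as many hyperedges as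
    the extremal number, whence the bound on average. *)

(** The vertices are labelled by a map [phi] into [G], since the extremal number
    is about hypergraphs on ['I_n] rather than on [G] itself. *)
Definition translate_hypergraph {T : finType} {G : finZmodType} (phi : T -> G)
    (r : nat) (A : {set G}) (a : G) : {set {set T}} :=
  [set e : {set T} | (#|e| == r) && (a + \sum_(v in e) phi v \in A)].

Lemma uniform_translate_hypergraph {T : finType} {G : finZmodType}
    (phi : T -> G) (r : nat) (A : {set G}) (a : G) :
  uniform r (translate_hypergraph phi r A a).
Proof. by apply/forall_inP => e; rewrite inE => /andP[]. Qed.

(** The sums are exchanged: for fixed [e], the condition on [a] says that [a]
    lies in a translate of [A], which has as many elements as [A]. *)
Lemma sum_card_translate_hypergraph {T : finType} {G : finZmodType}
    (phi : T -> G) (r : nat) (A : {set G}) :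
  (\sum_a #|translate_hypergraph phi r A a| = 'C(#|T|, r) * #|A|)%N.
Proof.
have card_translate (s : G) : (\sum_(a : G | (a + s)%R \in A) 1 = #|A|)%N.
  rewrite -sum1_card (reindex (fun b : G => b - s)) /=.
    by apply: eq_bigl => b; rewrite subrK.
  by exists (fun b => b + s) => b _; rewrite ?subrK ?addrK.
under eq_bigr => a _ do rewrite -sum1_card.
rewrite (exchange_big_dep [pred e : {set T} | #|e| == r]) /=; last first.
  by move=> a e _; rewrite inE => /andP[].
under eq_bigr => e e_r.
  under eq_bigl => a do rewrite inE e_r /=.
  rewrite card_translate.
  over.
by rewrite sum_nat_const -card_draws cardsE.
Qed.

(** The vertices of a hyperedge are distinct, so summing its labels amounts to
    summing one label from each class. A copy thus turns every choice of one
    element from each class into an element of [A], up to translation by [a];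
    injectivity of [phi] and of the copy gives the classes the right sizes. *)
Lemma translate_hypergraph_free {T : finType} {G : finZmodType} {phi : T -> G}
    {r : nat} {l : 'I_r -> nat} {A : {set G}} (r_gt0 : (0 < r)%N)
    (phi_inj : injective phi) (A_free : sumset_free l A) (a : G) :
  ~~ contains_copy (complete_multipartite l) (translate_hypergraph phi r A a).
Proof.
apply/negP => /existsP[f /andP[/injectiveP f_inj /forall_inP copy]].
pose i0 := Ordinal r_gt0.
(* The translation is put into the class [i0] alone, so that it contributes [a]
   exactly once to each sum. *)
pose shift i : G := if i == i0 then a else 0.
pose point i (j : 'I_(l i)) : G :=
  shift i + phi (f (Tagged (fun i => 'I_(l i)) j)).
have point_inj i : injective (@point i).
  by move=> j k /addrI/phi_inj/f_inj/eqP; rewrite eq_Tagged => /eqP.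
pose L := [ffun i => [set point i j | j : 'I_(l i)]].
have cardL i : #|L i| == l i.
  by rewrite ffunE (card_imset _ (point_inj i)) card_ord.
move/forallP/(_ L): A_free; rewrite (introT forallP cardL) /= => /negP; apply.
apply/subsetP => _ /imsetP[x /familyP xL ->].
have choose_vertex i : exists j, x i == point i j.
  by have := xL i; rewrite ffunE => /imsetP[j _ ->]; exists j.
pose y : {dffun forall i : 'I_r, 'I_(l i)} :=
  [ffun i => xchoose (choose_vertex i)].
pose vertex i := Tagged (fun i => 'I_(l i)) (y i).
have xE i : x i = shift i + phi (f (vertex i)).
  by rewrite (eqP (xchooseP (choose_vertex i))) /point /vertex ffunE.
have vertex_inj : injective vertex by move=> i j /(congr1 tag).
have := copy [set vertex i | i : 'I_r] (imset_f _ (isT : y \in predT)).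
rewrite inE => /andP[_].
rewrite big_imset /=; last by move=> u v _ _; apply: f_inj.
rewrite big_imset /=; last by move=> i j _ _; apply: vertex_inj.
under [X in _ -> X \in _]eq_bigr => i _ do rewrite xE.
by rewrite big_split /= -big_mkcond big_pred1_eq.
Qed.

Lemma sumset_free_le_turan {r : nat} {l : 'I_r -> nat} {G : finZmodType}
    {A : {set G}} : (0 < r)%N -> sumset_free l A ->
  ('C(#|G|, r) * #|A|
     <= #|G| * turan_number #|G| r (complete_multipartite l))%N.
Proof.
move=> r_gt0 A_free; pose phi (v : 'I_#|G|) : G := enum_val v.
have phi_inj : injective phi by apply: enum_val_inj.
rewrite -{1}[#|G|]card_ord -(sum_card_translate_hypergraph phi).
rewrite -sum_nat_const; apply: leq_sum => a _.
apply: (leq_bigmax_cond (F := fun E : {set {set 'I_#|G|}} => #|E|)).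
by rewrite uniform_translate_hypergraph translate_hypergraph_free.
Qed.

Theorem proposition2 (r : nat) (l : 'I_r -> nat) (G : finZmodType) (n : nat)
    (hr : (2 <= r)%N)
    (hl2 : forall i : 'I_r, (2 <= l i)%N)
    (hlmono : forall i j : 'I_r, (i <= j)%N -> (l i <= l j)%N)
    (hn : #|G| = n) :
  (turan_number n r (complete_multipartite l))%:R
    >= 'C(n, r)%:R * ((max_sumset_free G l)%:R / n%:R) :> rat.
Proof.
subst n.
have G_gt0 : (0 < #|G|)%N by apply/card_gt0P; exists 0.
rewrite mulrA ler_pdivrMr ?ltr0n // -!natrM ler_nat [leqRHS]mulnC.
rewrite /max_sumset_free; elim/big_ind: _ => [|p q hp hq|A A_free].
- by rewrite muln0.
- by rewrite maxnMr geq_max hp hq.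
- by apply: sumset_free_le_turan => //; apply: ltnW.
Qed.
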